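(* For the Chaplygin sphere, the characteristic distribution $\mathcal{U}\subset T\mathcal{R}$ of the reduced standard nonholonomic bracket $\{\cdot,\cdot\}_{\mathcal{R}}$, $$\mathcal{U}_z=\{X_F^{\mathcal{R}}(z): F\in C^\infty(\mathcal{R})\}\subset T_z\mathcal{R},\qquad z\in\mathcal{R},$$ is non-integrable.
   Context: Chaplygin sphere and its standard reduced bracket: an inhomogeneous sphere of mass $m>0$, radius $r>0$ and inertia tensor $\mathbb{I}=\mathrm{diag}(I_1,I_2,I_3)$, $I_i>0$, rolls without slipping on a plane. Its configuration space is $Q=SO(3)\times\mathbb{R}^2\ni(g;(x,y))$, with Lagrangian $\mathcal{L}=\frac12(\mathbb{I}\omega^b)\cdot\omega^b+\frac12m(v_x^2+v_y^2)$ and constraints $v_x=r\omega^s_2$, $v_y=-r\omega^s_1$, where $\hat\omega^b=g^{-1}\dot g$, $\omega^s=g\omega^b$ (hat map $\hat{\mathbf v}\mathbf w=\mathbf v\times\mathbf w$). $\mathcal{M}\subset T^*Q$ is the image of the constraint distribution under the Legendre transform. Let $\mathcal{C}\subset T\mathcal{M}$ be the distribution of vectors whose projection to $TQ$ satisfies the constraints, and $\mathcal{P}$ the projector onto $\mathcal{C}$ along its $\Omega_Q$-orthogonal complement in $T_{\mathcal{M}}(T^*Q)$, $\Omega_Q=dq_a\wedge dp_a$ being the canonical symplectic form. The standard nonholonomic bracket on $\mathcal{M}$ is $\{f_1,f_2\}_{\mathcal{M}}=\Omega_Q(\mathcal{P}X_{\bar f_1},\mathcal{P}X_{\bar f_2})$,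 with $\bar f_i$ arbitrary extensions of $f_i$ to $T^*Q$ and $\mathbf{i}_{X_{\bar f}}\Omega_Q=d\bar f$. It is invariant under the cotangent lift of the $SE(2)$ action $(h;a,b):(g;(x,y))\mapsto(hg;(x,y)\tilde h^t+(a,b))$, with $h=\begin{pmatrix}\tilde h&0\\0&1\end{pmatrix}$, $\tilde h\in SO(2)$, and it induces the bracket $\{\cdot,\cdot\}_{\mathcal{R}}$ on $\mathcal{R}=\mathcal{M}/SE(2)$ by $\{F_1,F_2\}_{\mathcal{R}}\circ\pi=\{F_1\circ\pi,F_2\circ\pi\}_{\mathcal{M}}$, $\pi$ the orbit projection. Explicit description: $\mathcal{R}$ is identified with $\{(\mathbf K^b,\gamma)\in\mathbb{R}^3\times\mathbb{R}^3:\|\gamma\|=1\}\cong\mathbb{R}^3\times S^2$, where $\gamma=g^{-1}e_3$ and $\mathbf K^b=\mathbb{I}\omega^b+mr^2(\omega^b-(\omega^b\cdot\gamma)\gamma)$ is the angular momentum about the contact point in body coordinates, and the bracket $\{\cdot,\cdot\}_{\mathcal{R}}$ is the (bilinear, skew-symmetric, Leibniz) bracket determined by $$\{K^b_i,K^b_j\}_{\mathcal{R}}=-c_{ijl}\bigl(K^b_l+mr^2(\omega^b_l-\omega^s_3\gamma_l)\bigr),\quad\{K^b_i,\gamma_j\}_{\mathcal{R}}=-c_{ijl}\gamma_l,\quad\{\gamma_i,\gamma_j\}_{\mathcal{R}}=0,$$ where $c_{ijl}$ is the Levi-Civita symbol and, with $A=\mathbb{I}+mr^2E$ ($E$ the identity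 matrix), $Y(\gamma)=1-mr^2(\gamma\cdot A^{-1}\gamma)>0$, $\omega^s_3=\frac{\mathbf K^b\cdot A^{-1}\gamma}{Y(\gamma)}$, $\omega^b=A^{-1}\mathbf K^b+mr^2\omega_3^sA^{-1}\gamma$. ($\|\gamma\|^2$ is a Casimir, so these formulas define a bracket on $\mathcal{R}$.) For $F\in C^\infty(\mathcal{R})$, $X_F^{\mathcal{R}}$ is the vector field with $X_F^{\mathcal{R}}(F_2)=\{F_2,F\}_{\mathcal{R}}$ for all $F_2\in C^\infty(\mathcal{R})$. Non-integrable is meant in the sense of Frobenius' theorem: $\mathcal{U}$ is not closed under Lie brackets of its sections, hence is not tangent to a foliation. *)

(* Defs.v *)
From HB Require Import structures.
From mathcomp Require Import all_boot all_order all_algebra.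
From mathcomp Require Import all_classical all_reals all_analysis.
From mathcomp Require Import ring.
Set Implicit Arguments.
Unset Strict Implicit.
Unset Printing Implicit Defensive.
Import Order.TTheory GRing.Theory Num.Theory.
Import numFieldNormedType.Exports.
Local Open Scope classical_set_scope.
Local Open Scope ring_scope.

(* C^k on an open set O: Fréchet differentiable with C^(k-1) differential.
   On a finite-dimensional V, continuity of the differential in operator norm
   is the same as continuity of x |-> 'd f x v for each fixed v. *)
Fixpoint Ck_on (R : realType) (V W : normedModType R) (k : nat) (O : set V)
    (f : V -> W) : Prop :=
  match k with
  | 0 => forall x, O x -> {for x, continuous f}
  | k'.+1 => (forall x, O x -> differentiable f x) /\
             (forall v, Ck_on k' O (fun x => 'd f x v))
  end.

(* A smooth map on an embedded submanifold S of V is represented by any map on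
   V that is smooth on some open neighbourhood of S; only its restriction to S
   is meaningful (its values away from S are irrelevant). *)
Definition smooth_along (R : realType) (V W : normedModType R) (S : set V)
    (f : V -> W) : Prop :=
  exists O : set V, [/\ open O, S `<=` O & forall k, Ck_on k O f].

Definition dot (R : realType) (u v : 'cV[R]_3) : R := \sum_i u i 0 * v i 0.

Definition levi_civita (R : realType) (i j l : 'I_3) : R :=
  let t := (val i, val j, val l) in
  if t \in [:: (0, 1, 2); (1, 2, 0); (2, 0, 1)]%N then 1
  else if t \in [:: (0, 2, 1); (2, 1, 0); (1, 0, 2)]%N then -1 else 0.

(* z = (K, gamma) *)
Definition ambient (R : realType) : normedModType R :=
  ('cV[R]_3 * 'cV[R]_3)%type.

Definition reduced_space (R : realType) : set (ambient R) :=
  [set z | dot z.2 z.2 = 1].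

Definition tangent_space (R : realType) (z : ambient R) : set (ambient R) :=
  [set v | dot z.2 v.2 = 0].

Definition smooth_function (R : realType) (F : ambient R -> R) : Prop :=
  smooth_along (@reduced_space R) (F : ambient R -> R^o).

Definition vector_field (R : realType) (X : ambient R -> ambient R) : Prop :=
  smooth_along (@reduced_space R) X /\
  forall z, reduced_space z -> tangent_space z (X z).

Definition dK (R : realType) (F : ambient R -> R) (i : 'I_3) (z : ambient R)
    : R :=
  'd (F : ambient R -> R^o) z ((delta_mx i 0, 0) : ambient R).

Definition dgamma (R : realType) (F : ambient R -> R) (i : 'I_3)
    (z : ambient R) : R :=
  'd (F : ambient R -> R^o) z ((0, delta_mx i 0) : ambient R).

(* The parameters are the mass m, the radius r and the principal moments of
   inertia I. *)
Definition A_mx (R : realType) (m r : R) (I : 'rV[R]_3) : 'M[R]_3 :=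
  diag_mx I + (m * r ^+ 2)%:M.

Definition Y_fun (R : realType) (m r : R) (I : 'rV[R]_3) (gamma : 'cV[R]_3) : R :=
  1 - m * r ^+ 2 * dot gamma (invmx (A_mx m r I) *m gamma).

Definition omega_s3 (R : realType) (m r : R) (I : 'rV[R]_3) (z : ambient R)
    : R :=
  dot z.1 (invmx (A_mx m r I) *m z.2) / Y_fun m r I z.2.

Definition omega_b (R : realType) (m r : R) (I : 'rV[R]_3) (z : ambient R)
    : 'cV[R]_3 :=
  invmx (A_mx m r I) *m z.1 +
  (m * r ^+ 2 * omega_s3 m r I z) *: (invmx (A_mx m r I) *m z.2).

(* {K_i, K_j} *)
Definition brKK (R : realType) (m r : R) (I : 'rV[R]_3) (i j : 'I_3)
    (z : ambient R) : R :=
  - \sum_l levi_civita R i j l *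
      (z.1 l 0 + m * r ^+ 2 * (omega_b m r I z l 0 -
                               omega_s3 m r I z * z.2 l 0)).

(* {K_i, gamma_j} *)
Definition brKgamma (R : realType) (i j : 'I_3) (z : ambient R) : R :=
  - \sum_l levi_civita R i j l * z.2 l 0.

(* The biderivation with the above values on the coordinate functions, and with
   {gamma_i, gamma_j} = 0. The lemmas below check that it is skew-symmetric,
   bilinear and Leibniz, that it has the prescribed values on the coordinates,
   and (bracket_restr) that on the reduced space it depends only on the
   restrictions of F and G to the reduced space. *)
Definition bracket (R : realType) (m r : R) (I : 'rV[R]_3)
    (F G : ambient R -> R) (z : ambient R) : R :=
  \sum_i \sum_j (dK F i z * dK G j z * brKK m r I i j z
                 + dK F i z * dgamma G j z * brKgamma i j z
                 - dgamma F j z * dK G i z * brKgamma i j z).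

Definition is_hamiltonian_vf (R : realType) (m r : R) (I : 'rV[R]_3)
    (F : ambient R -> R) (X : ambient R -> ambient R) : Prop :=
  vector_field X /\
  forall F2, smooth_function F2 -> forall z, reduced_space z ->
    'd (F2 : ambient R -> R^o) z (X z) = bracket m r I F2 F z.

Definition char_distribution (R : realType) (m r : R) (I : 'rV[R]_3)
    (z : ambient R) : set (ambient R) :=
  [set v | exists F X, [/\ smooth_function F, is_hamiltonian_vf m r I F X
                         & v = X z]].

Definition section_of (R : realType) (U : ambient R -> set (ambient R))
    (X : ambient R -> ambient R) : Prop :=
  vector_field X /\ forall z, reduced_space z -> U z (X z).

(* [X, Y](F) = X(Y(F)) - Y(X(F)); on the reduced space this depends only on the
   restrictions of X and Y, since these are tangent to it. *)
Definition lie_bracket (R : realType) (X Y : ambient R -> ambient R)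
    (z : ambient R) : ambient R :=
  'd Y z (X z) - 'd X z (Y z).

Definition frobenius_integrable (R : realType)
    (U : ambient R -> set (ambient R)) : Prop :=
  forall X Y, section_of U X -> section_of U Y ->
    forall z, reduced_space z -> U z (lie_bracket X Y z).

Section bracket_theory.
Variables (R : realType) (m r : R) (I : 'rV[R]_3).
Implicit Types (F G H : ambient R -> R) (z : ambient R).
Local Notation br := (bracket m r I).

Lemma levi_civitaC i j l : levi_civita R i j l = - levi_civita R j i l.
Proof.
rewrite /levi_civita.
case: i => [[|[|[|?]]] ?] //.
all: case: j => [[|[|[|?]]] ?] //.
all: case: l => [[|[|[|?]]] ?] //; rewrite /=.
all: by rewrite ?oppr0 ?opprK.
Qed.

Lemma bracket_skew F G z : br F G z = - br G F z.
Proof.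
have KKC i j : brKK m r I i j z = - brKK m r I j i z.
  by rewrite /brKK opprK -sumrN; apply: eq_bigr => l _;
     rewrite levi_civitaC mulNr opprK.
have sp F1 F2 : br F1 F2 z =
  (\sum_i \sum_j dK F1 i z * dK F2 j z * brKK m r I i j z) +
  (\sum_i \sum_j (dK F1 i z * dgamma F2 j z - dgamma F1 j z * dK F2 i z)
     * brKgamma i j z).
  rewrite -big_split /=; apply: eq_bigr => i _; rewrite -big_split /=.
  by apply: eq_bigr => j _; rewrite mulrBl addrA.
rewrite !sp opprD; congr (_ + _).
  rewrite [LHS]exchange_big /= -sumrN; apply: eq_bigr => i _; rewrite -sumrN.
  apply: eq_bigr => j _; rewrite KKC.
  by move: (dK F j z) (dK G i z) (brKK _ _ _ _ _ _) => a b c; ring.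
rewrite -sumrN; apply: eq_bigr => i _; rewrite -sumrN.
apply: eq_bigr => j _; move: (dK F i z) (dK G i z) (dgamma F j z).
by move: (dgamma G j z) (brKgamma _ _ _) => a b c d e; ring.
Qed.

Definition ham_vec G z : ambient R :=
  (\col_i \sum_j (dK G j z * brKK m r I i j z + dgamma G j z * brKgamma i j z),
   \col_j - \sum_i dK G i z * brKgamma i j z).

Lemma bracketE F G z :
  br F G z = 'd (F : ambient R -> R^o) z (ham_vec G z).
Proof.
set f := 'd (F : ambient R -> R^o) z.
have ldec v : f v = \sum_i (v.1 i 0 * dK F i z + v.2 i 0 * dgamma F i z).
  have {1}-> : v = \sum_i (v.1 i 0 *: ((delta_mx i 0, 0) : ambient R)
                      + v.2 i 0 *: ((0, delta_mx i 0) : ambient R)).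
    have cdec (a : 'cV[R]_3) : a = \sum_i a i 0 *: delta_mx i 0.
      rewrite [LHS]matrix_sum_delta; apply: eq_bigr => i _.
      by rewrite big_ord1.
    rewrite [LHS]surjective_pairing [RHS]surjective_pairing; congr (_, _).
      rewrite (big_morph (fun p : ambient R => p.1) (fun _ _ => erefl) erefl).
      rewrite [LHS]cdec; apply: eq_bigr => i _.
      by rewrite /= scaler0 addr0.
    rewrite (big_morph (fun p : ambient R => p.2) (fun _ _ => erefl) erefl).
    rewrite [LHS]cdec; apply: eq_bigr => i _.
    by rewrite /= scaler0 add0r.
  rewrite linear_sum; apply: eq_bigr => i _.
  by rewrite linearD !linearZ.
rewrite ldec big_split /= /bracket.
under [X in _ + X]eq_bigr do rewrite mxE mulNr mulr_suml -sumrN.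
rewrite [X in _ + X]exchange_big /= -big_split /=; apply: eq_bigr => i _.
rewrite mxE mulr_suml -big_split /=; apply: eq_bigr => j _; ring.
Qed.

Lemma ham_vec_tangent G z : tangent_space z (ham_vec G z).
Proof.
rewrite /tangent_space /= /dot /ham_vec /=.
under eq_bigr do rewrite mxE mulrN mulr_sumr -sumrN.
rewrite exchange_big /= big1 // => i _.
under eq_bigr do rewrite mulrCA -mulrN.
rewrite -mulr_sumr /brKgamma sumrN.
under eq_bigr do rewrite mulrN mulr_sumr -sumrN.
rewrite !big_ord_recl !big_ord0 /levi_civita.
by case: i => [[|[|[|?]]] ?] //; rewrite !inE /=; ring.
Qed.

Let diff_at F z := differentiable (F : ambient R -> R^o) z.

Lemma bracketDl F G H z : diff_at F z -> diff_at G z ->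
  br (fun x => F x + G x) H z = br F H z + br G H z.
Proof.
move=> dF dG; rewrite 3!bracketE; move: (ham_vec H z) => v.
exact: (f_equal (fun h : ambient R -> R^o => h v) (diffD dF dG)).
Qed.

Lemma bracketZl (a : R) F H z : diff_at F z ->
  br (fun x => a * F x) H z = a * br F H z.
Proof.
move=> dF; rewrite 2!bracketE; move: (ham_vec H z) => v.
exact: (f_equal (fun h : ambient R -> R^o => h v) (diffZ a dF)).
Qed.

Lemma bracket_leibniz F G H z : diff_at F z -> diff_at G z ->
  br (fun x => F x * G x) H z = F z * br G H z + G z * br F H z.
Proof.
move=> dF dG; rewrite 3!bracketE; move: (ham_vec H z) => v.
exact: (f_equal (fun h : ambient R -> R^o => h v) (diffM dF dG)).
Qed.

Let cK i (x : ambient R) : R^o := x.1 i 0.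
Let cgamma i (x : ambient R) : R^o := x.2 i 0.

Lemma diff_cK i z v : 'd (cK i) z v = v.1 i 0.
Proof.
have lin : linear (cK i) by move=> a x y; rewrite /cK /= !mxE.
pose f : {linear ambient R -> R^o} := HB.pack (cK i) (GRing.isLinear.Build _ _ _ _ _ lin).
have cf : continuous f.
  move=> x; apply: (@continuous_comp _ _ _ (@fst _ _ : ambient R -> _)
    (fun M : 'cV[R]_3 => M i 0 : R^o)); last exact: coord_continuous.
  exact: cvg_fst.
exact: (f_equal (fun h : ambient R -> R^o => h v) (diff_lin z cf)).
Qed.

Lemma diff_cgamma i z v : 'd (cgamma i) z v = v.2 i 0.
Proof.
have lin : linear (cgamma i) by move=> a x y; rewrite /cgamma /= !mxE.
pose f : {linear ambient R -> R^o} := HB.pack (cgamma i) (GRing.isLinear.Build _ _ _ _ _ lin).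
have cf : continuous f.
  move=> x; apply: (@continuous_comp _ _ _ (@snd _ _ : ambient R -> _)
    (fun M : 'cV[R]_3 => M i 0 : R^o)); last exact: coord_continuous.
  exact: cvg_snd.
exact: (f_equal (fun h : ambient R -> R^o => h v) (diff_lin z cf)).
Qed.

Let dKE i j z : dK (cK j) i z = (i == j)%:R.
Proof. by rewrite /dK diff_cK mxE andbT eq_sym. Qed.
Let dKE' i j z : dK (cgamma j) i z = 0.
Proof. by rewrite /dK diff_cgamma mxE. Qed.
Let dgE i j z : dgamma (cgamma j) i z = (i == j)%:R.
Proof. by rewrite /dgamma diff_cgamma mxE andbT eq_sym. Qed.
Let dgE' i j z : dgamma (cK j) i z = 0.
Proof. by rewrite /dgamma diff_cK mxE. Qed.

Let sum_delta (f : 'I_3 -> R) j : \sum_i (i == j)%:R * f i = f j.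
Proof.
rewrite (bigD1 j) //= eqxx mul1r big1 ?addr0 // => i /negbTE ->.
by rewrite mul0r.
Qed.

Lemma bracketKK i j z :
  br (fun x => x.1 i 0) (fun x => x.1 j 0) z = brKK m r I i j z.
Proof.
rewrite bracketE (diff_cK i) mxE.
under eq_bigr do rewrite (dKE _ j) (dgE' _ j) mul0r addr0.
exact: sum_delta.
Qed.

Lemma bracketKgamma i j z :
  br (fun x => x.1 i 0) (fun x => x.2 j 0) z = brKgamma i j z.
Proof.
rewrite bracketE (diff_cK i) mxE.
under eq_bigr do rewrite (dKE' _ j) (dgE _ j) mul0r add0r.
exact: sum_delta.
Qed.

Lemma bracket_gammagamma i j z :
  br (fun x => x.2 i 0) (fun x => x.2 j 0) z = 0.
Proof.
rewrite bracketE (diff_cgamma i) mxE big1 ?oppr0 // => k _.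
by rewrite (dKE' _ j) mul0r.
Qed.

Lemma diff_restr F1 F2 z v : smooth_function F1 -> smooth_function F2 ->
  (forall x, reduced_space x -> F1 x = F2 x) ->
  reduced_space z -> tangent_space z v ->
  'd (F1 : ambient R -> R^o) z v = 'd (F2 : ambient R -> R^o) z v.
Proof.
have sd F : smooth_function F -> reduced_space z -> diff_at F z.
  by move=> [U [_ sU kU]] Rz; have [+ _] := kU 1%N; apply; exact: sU.
move=> sF1 sF2 eqF Rz Tv.
pose a := dot v.2 v.2 / 4.
pose q t : R := 1 + a * t ^+ 2.
have a0 : 0 <= a.
  by rewrite divr_ge0 // sumr_ge0 // => i _; rewrite -expr2 sqr_ge0.
have q0 t : q t != 0 by rewrite gt_eqF // ltr_wpDr // mulr_ge0 // sqr_ge0.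
pose c1 (t : R^o) : 'cV[R]_3 := z.1 + t *: v.1.
pose c2 (t : R^o) : 'cV[R]_3 :=
  ((1 - a * t ^+ 2) / q t) *: z.2 + (t / q t) *: v.2.
pose c (t : R^o) : ambient R := (c1 t, c2 t).
have Rc t : reduced_space (c t).
  have dE (x y : R) : dot (x *: z.2 + y *: v.2) (x *: z.2 + y *: v.2)
     = x ^+ 2 * dot z.2 z.2 + 2 * x * y * dot z.2 v.2 + y ^+ 2 * dot v.2 v.2.
    rewrite /dot !mulr_sumr -!big_split /=; apply: eq_bigr => i _.
    by rewrite !mxE; ring.
  rewrite /reduced_space /= dE; move: Rz Tv; rewrite /reduced_space /tangent_space /= => -> ->.
  have -> : dot v.2 v.2 = 4 * a by rewrite /a mulrC divfK.
  by have := q0 t; rewrite /q => h; field.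
have c0 : c 0 = z.
  rewrite /c /c1 /c2 /q expr0n /= mulr0 subr0 addr0 divr1 scale1r mul0r.
  by rewrite !scale0r !addr0 -surjective_pairing.
have dX : is_diff (0 : R^o) ((@id R^o) ^+ 2 : R^o -> R^o) (0 : R^o -> R^o).
  by apply: is_diff_eq; rewrite expr1 mulr0; apply/funext => h; apply: scale0r.
pose N : R^o -> R^o := cst 1 - a *: ((@id R^o) ^+ 2 : R^o -> R^o).
pose D : R^o -> R^o := cst 1 + a *: ((@id R^o) ^+ 2 : R^o -> R^o).
have dN : is_diff (0 : R^o) N (0 : R^o -> R^o).
  apply: (is_diff_eq (is_diffB (is_diff_cst (1 : R^o) (0 : R^o))
    (is_diffZ a dX))).
  by apply/funext => h; rewrite -[LHS]/(0 - a * 0) mulr0 subr0.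
have dD : is_diff (0 : R^o) D (0 : R^o -> R^o).
  apply: (is_diff_eq (is_diffD (is_diff_cst (1 : R^o) (0 : R^o))
    (is_diffZ a dX))).
  by apply/funext => h; rewrite -[LHS]/(0 + a * 0) mulr0 addr0.
have D0 t : D t != 0 by exact: q0.
pose V : R^o -> R^o := fun t => (D t)^-1.
have dV : is_diff (0 : R^o) V (0 : R^o -> R^o).
  have DV := differentiableV (@ex_diff _ _ _ _ _ _ _ dD) (D0 0).
  apply: DiffDef; first exact: DV.
  rewrite [LHS](diffV (@ex_diff _ _ _ _ _ _ _ dD) (D0 0)).
  rewrite (@diff_val _ _ _ _ _ _ _ dD).
  by apply/funext => h; apply: mulr0.
have V0 : V 0 = 1.
  rewrite /V -[D 0]/(1 + a * (0 ^+ 2)).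
  by rewrite expr0n /= mulr0 addr0 invr1.
have dp : is_diff (0 : R^o) (N * V : R^o -> R^o) (0 : R^o -> R^o).
  apply: (is_diff_eq (is_diffM dN dV)).
  by apply/funext => h; rewrite -[LHS]/(N 0 * 0 + V 0 * 0) !mulr0 addr0.
have ds : is_diff (0 : R^o) ((@id R^o) * V : R^o -> R^o) (@id R^o).
  apply: (is_diff_eq (is_diffM (is_diff_id (0 : R^o)) dV)).
  by apply/funext => h; rewrite -[LHS]/(0 * 0 + V 0 * h) V0 mul0r add0r mul1r.
have dc1 : is_diff (0 : R^o) c1 (fun t => t *: v.1).
  apply: (is_diff_eq (is_diffD (is_diff_cst z.1 (0 : R^o))
    (is_diff_scalel (0 : R^o) v.1))).
  by apply/funext => h; apply: add0r.
have dc2 : is_diff (0 : R^o) c2 (fun t => t *: v.2).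
  have -> : c2 = ((fun t => t *: z.2) \o (N * V : R^o -> R^o)) +
       ((fun t => t *: v.2) \o (@id R^o * V : R^o -> R^o)).
    by apply/funext => t.
  have d1 := is_diff_comp dp (is_diff_scalel ((N * V : R^o -> R^o) 0) z.2).
  have d2 := is_diff_comp ds (is_diff_scalel ((@id R^o * V : R^o -> R^o) 0) v.2).
  apply: (is_diff_eq (is_diffD d1 d2)).
  by apply/funext => h; rewrite -[LHS]/(0 *: z.2 + h *: v.2) scale0r add0r.
have dc : is_diff (0 : R^o) c (fun t => t *: v).
  by apply: (is_diff_eq (is_diff_pair dc1 dc2)).
have key F : diff_at F z ->
    'd ((F : ambient R -> R^o) \o c) (0 : R^o) 1 = 'd (F : ambient R -> R^o) z v.
  rewrite /diff_at -c0 => dF; rewrite diff_comp //= diff_val scale1r.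
  by rewrite c0.
rewrite -(key _ (sd _ sF1 Rz)) -(key _ (sd _ sF2 Rz)).
suff -> : (F1 : ambient R -> R^o) \o c = (F2 : ambient R -> R^o) \o c by [].
by apply/funext => t /=; apply: eqF.
Qed.

Lemma bracket_restr F1 F2 G1 G2 z :
  smooth_function F1 -> smooth_function F2 ->
  smooth_function G1 -> smooth_function G2 ->
  (forall x, reduced_space x -> F1 x = F2 x) ->
  (forall x, reduced_space x -> G1 x = G2 x) ->
  reduced_space z -> br F1 G1 z = br F2 G2 z.
Proof.
move=> sF1 sF2 sG1 sG2 eF eG Rz.
have := ham_vec_tangent G1 z; have := ham_vec_tangent F2 z.
move=> T2 T1; rewrite bracketE (diff_restr sF1 sF2 eF Rz T1) -bracketE.
by rewrite bracket_skew bracketE (diff_restr sG1 sG2 eG Rz T2) -bracketE -bracket_skew.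
Qed.

End bracket_theory.

(* Main.v *)
From HB Require Import structures.
Require Import Defs.
From mathcomp Require Import all_boot all_order all_algebra.
From mathcomp Require Import all_classical all_reals all_analysis.
From mathcomp Require Import ring.
Import Order.TTheory GRing.Theory Num.Theory.
Import numFieldNormedType.Exports.
Local Open Scope ring_scope.

(** The covector field that annihilates the characteristic distribution makes
    the non-integrability visible. Write mu = m r^2 and let M(z) be the vector
    with {K_i, K_j} = - c_ijl M_l, that is M = K + mu (omega - omega_3 gamma).
    A function G with gradients a = dG/dK and b = dG/dgamma has the Hamiltonian
    vector field (M x a + gamma x b, gamma x a), so the one-form
      alpha = gamma . dK + M . dgamma
    vanishes on every Hamiltonian vector field ([contact_form_ham_vec]). On the
    reduced space alpha = d(K . gamma) + mu omega . dgamma, hence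
    d alpha = mu (d omega_i /\ d gamma_i), and this does not vanish on the
    kernel of alpha: the rolling constraint, through the factor mu, twists the
    four-dimensional planes of the distribution.

    Concretely, it suffices to find two sections whose Lie bracket has nonzero
    alpha at one point. They are taken to be the Hamiltonian vector fields of
    gamma_0 and of Y K_0, at the point K = 0, gamma = e_2 (indices start
    at 0). There
      alpha([X_(gamma_0), X_(Y K_0)]) = - mu Y u . (d omega/dK) u
    with u = gamma x e_0 = e_1, which equals - mu Y / (I_1 + mu) and is not
    zero because Y > 0 on the unit sphere ([contact_form_lie_bracket]).

    Multiplying K_0 by Y is what keeps the analysis elementary: omega_3 has Y
    as its only non-constant denominator, so both vector fields coincide on the
    reduced space with polynomial maps of (K, gamma). Polynomial maps are stable
    under differentiation, which gives smoothness at once, and at the chosen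
    point they are affine along the directions that matter, which gives the
    required derivatives without differentiating products. *)

(** * Polynomial maps of a normed space and their smoothness *)

Section polynomial_maps.
Set Implicit Arguments.
Unset Strict Implicit.
Variables (R : realType) (V : normedModType R).

(** Generation from continuous linear forms, rather than from coordinates,
    makes sense in any normed space and makes stability under differentiation
    immediate by induction. *)
Inductive polynomial_function : (V -> R) -> Prop :=
| polynomial_cst c : polynomial_function (fun _ => c)
| polynomial_linear (l : {linear V -> R^o}) :
    continuous l -> polynomial_function l
| polynomialD p q : polynomial_function p -> polynomial_function q ->
    polynomial_function (fun z => p z + q z)
| polynomialM p q : polynomial_function p -> polynomial_function q ->
    polynomial_function (fun z => p z * q z).

Lemma polynomialZ c p : polynomial_function p ->
  polynomial_function (fun z => c * p z).
Proof. exact: (polynomialM (polynomial_cst c)). Qed.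

Lemma polynomialN p : polynomial_function p ->
  polynomial_function (fun z => - p z).
Proof.
move=> pp; have -> : (fun z => - p z) = (fun z => -1 * p z).
  by apply/funext => z; rewrite mulN1r.
exact: polynomialZ.
Qed.

Lemma polynomial_sum n (p : 'I_n -> V -> R) :
  (forall i, polynomial_function (p i)) ->
  polynomial_function (fun z => \sum_i p i z).
Proof.
elim: n p => [|n IHn] p pp.
  have -> : (fun z => \sum_(i < 0) p i z) = (fun _ => 0).
    by apply/funext => z; rewrite big_ord0.
  exact: polynomial_cst.
have -> : (fun z => \sum_i p i z) =
          (fun z => p ord0 z + \sum_(i < n) p (lift ord0 i) z).
  by apply/funext => z; rewrite big_ord_recl.
by apply: polynomialD; [exact: pp | apply: IHn => i; exact: pp].
Qed.

(** By the sum and product rules the class is stable under directional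
    differentiation; this closure replaces any explicit computation of higher
    derivatives. *)
Lemma polynomial_diff (p : V -> R) : polynomial_function p ->
  (forall z, differentiable (p : V -> R^o) z) /\
  (forall v, polynomial_function (fun z => 'd (p : V -> R^o) z v)).
Proof.
elim=> [c|l cl|{}p q pp [dp Dp] pq [dq Dq]|{}p q pp [dp Dp] pq [dq Dq]].
- split=> [z|v]; first exact: (@differentiable_cst _ _ R^o c z).
  have -> : (fun z => 'd ((fun=> c) : V -> R^o) z v) = (fun _ => 0).
    apply/funext => z; exact: (f_equal (fun h : V -> R^o => h v)
      (@diff_cst _ V R^o c z)).
  exact: polynomial_cst.
- split=> [z|v]; first exact: linear_differentiable.
  have -> : (fun z => 'd (l : V -> R^o) z v) = (fun _ => l v).
    by apply/funext => z; rewrite diff_lin.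
  exact: polynomial_cst.
- split=> [z|v]; first exact: (differentiableD (dp z) (dq z)).
  have -> : (fun z => 'd ((fun z => p z + q z) : V -> R^o) z v) =
            (fun z => 'd (p : V -> R^o) z v + 'd (q : V -> R^o) z v).
    apply/funext => z; exact: (f_equal (fun h : V -> R^o => h v)
      (diffD (dp z) (dq z))).
  exact: polynomialD.
- split=> [z|v]; first exact: (differentiableM (dp z) (dq z)).
  have -> : (fun z => 'd ((fun z => p z * q z) : V -> R^o) z v) =
            (fun z => p z * 'd (q : V -> R^o) z v
                    + q z * 'd (p : V -> R^o) z v).
    apply/funext => z; exact: (f_equal (fun h : V -> R^o => h v)
      (diffM (dp z) (dq z))).
  by apply: polynomialD; apply: polynomialM.
Qed.

Variable W : normedModType R.

Inductive polynomial_map : (V -> W) -> Prop :=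
| polynomial_map_scale p w :
    polynomial_function p -> polynomial_map (fun z => p z *: w)
| polynomial_mapD f g : polynomial_map f -> polynomial_map g ->
    polynomial_map (fun z => f z + g z).

Lemma polynomial_map_sum n (f : 'I_n -> V -> W) :
  (forall i, polynomial_map (f i)) ->
  polynomial_map (fun z => \sum_i f i z).
Proof.
elim: n f => [|n IHn] f pf.
  have -> : (fun z => \sum_(i < 0) f i z) = (fun _ => 0 *: 0).
    by apply/funext => z; rewrite big_ord0 scaler0.
  exact/polynomial_map_scale/polynomial_cst.
have -> : (fun z => \sum_i f i z) =
          (fun z => f ord0 z + \sum_(i < n) f (lift ord0 i) z).
  by apply/funext => z; rewrite big_ord_recl.
by apply: polynomial_mapD; [exact: pf | apply: IHn => i; exact: pf].
Qed.

Lemma polynomial_map_diff (f : V -> W) : polynomial_map f ->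
  (forall z, differentiable f z) /\
  (forall v, polynomial_map (fun z => 'd f z v)).
Proof.
elim=> [p w /polynomial_diff [dp Dp]|{}f g pf [df Df] pg [dg Dg]].
- have ds z : is_diff z (fun z => p z *: w)
      (fun v => ('d (p : V -> R^o) z v : R) *: w).
    exact: (is_diff_comp (differentiableP (dp z))
      (is_diff_scalel (p z) w)).
  split=> [z|v]; first exact: (@ex_diff _ _ _ _ _ _ _ (ds z)).
  have -> : (fun z => 'd (fun z => p z *: w) z v) =
            (fun z => ('d (p : V -> R^o) z v : R) *: w).
    by apply/funext => z; rewrite (@diff_val _ _ _ _ _ _ _ (ds z)).
  exact: polynomial_map_scale.
- split=> [z|v]; first exact: (differentiableD (df z) (dg z)).
  have -> : (fun z => 'd (fun z => f z + g z) z v) =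
            (fun z => 'd f z v + 'd g z v).
    apply/funext => z; exact: (f_equal (fun h : V -> W => h v)
      (diffD (df z) (dg z))).
  exact: polynomial_mapD.
Qed.

(** One derivative at a time, the directional differentials stay in the class,
    so differentiability alone propagates to all orders. *)
Lemma polynomial_map_smooth S (f : V -> W) :
  polynomial_map f -> smooth_along S f.
Proof.
move=> pf; exists setT; split=> [|//|k]; first exact: openT.
elim: k f pf => [|k IHk] f /polynomial_map_diff [df Df] /=.
  by move=> z _; exact/differentiable_continuous.
by split=> [z _|v]; [exact: df | exact: IHk].
Qed.

(** The differential in the direction v only sees the restriction of f to the
    line z + t v; all the derivatives needed below are taken along lines on
    which the map is affine. *)
Lemma diff_affine (f : V -> W) z v w : differentiable f z ->
  (forall t : R, f (z + t *: v) = f z + t *: w) -> 'd f z v = w.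
Proof.
move=> df fE; pose c (t : R^o) : V := z + t *: v.
have c0 : c 0 = z by rewrite /c scale0r addr0.
have dc : is_diff (0 : R^o) c (fun t => t *: v).
  apply: (is_diff_eq (is_diffD (is_diff_cst z (0 : R^o))
    (is_diff_scalel (0 : R^o) v))).
  by apply/funext => h; apply: add0r.
have dfc : is_diff (0 : R^o) (fun t : R^o => f z + t *: w) (fun t => t *: w).
  apply: (is_diff_eq (is_diffD (is_diff_cst (f z) (0 : R^o))
    (is_diff_scalel (0 : R^o) w))).
  by apply/funext => h; apply: add0r.
have dfz : differentiable f (c 0) by rewrite c0.
have := diff_comp (@ex_diff _ _ _ _ _ _ _ dc) dfz.
have -> : f \o c = (fun t : R^o => f z + t *: w) by apply/funext => t; exact: fE.
rewrite (@diff_val _ _ _ _ _ _ _ dfc) (@diff_val _ _ _ _ _ _ _ dc) c0.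
by move=> /(f_equal (fun h : R^o -> W => h 1)) /=; rewrite !scale1r.
Qed.

End polynomial_maps.

(** * The annihilator of the characteristic distribution *)

Section contact_form.
Set Implicit Arguments.
Unset Strict Implicit.
Variables (R : realType) (m r : R) (I : 'rV[R]_3).
Implicit Types (z v : ambient R) (i j l : 'I_3).

Lemma sum_I3 (f : 'I_3 -> R) : \sum_i f i = f 0 + f 1 + f 2.
Proof.
rewrite !big_ord_recl big_ord0 addr0 addrA.
by congr (f _ + f _ + f _); apply: val_inj.
Qed.

Lemma I3P (P : 'I_3 -> Prop) : P 0 -> P 1 -> P 2 -> forall i, P i.
Proof.
move=> P0 P1 P2 [[|[|[|//]]] hi]; [move: P0|move: P1|move: P2];
  by congr P; apply: val_inj.
Qed.

Lemma polynomial_K i : polynomial_function (fun z => z.1 i 0).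
Proof.
have lin : linear (fun z : ambient R => z.1 i 0 : R^o).
  by move=> a x y; rewrite /= !mxE.
pose f : {linear ambient R -> R^o} :=
  HB.pack (fun z : ambient R => z.1 i 0 : R^o)
          (GRing.isLinear.Build _ _ _ _ _ lin).
apply: (@polynomial_linear _ _ f) => x.
apply: (@continuous_comp _ _ _ (@fst _ _ : ambient R -> _)
  (fun M : 'cV[R]_3 => M i 0 : R^o)); last exact: coord_continuous.
exact: cvg_fst.
Qed.

Lemma polynomial_gamma i : polynomial_function (fun z => z.2 i 0).
Proof.
have lin : linear (fun z : ambient R => z.2 i 0 : R^o).
  by move=> a x y; rewrite /= !mxE.
pose f : {linear ambient R -> R^o} :=
  HB.pack (fun z : ambient R => z.2 i 0 : R^o)
          (GRing.isLinear.Build _ _ _ _ _ lin).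
apply: (@polynomial_linear _ _ f) => x.
apply: (@continuous_comp _ _ _ (@snd _ _ : ambient R -> _)
  (fun M : 'cV[R]_3 => M i 0 : R^o)); last exact: coord_continuous.
exact: cvg_snd.
Qed.

Lemma polynomial_smooth_function (F : ambient R -> R) :
  polynomial_function F -> smooth_function F.
Proof.
move=> pF; apply: polynomial_map_smooth.
have -> : F = (fun z => F z *: (1 : R^o)).
  by apply/funext => z; exact/esym/mulr1.
exact: polynomial_map_scale.
Qed.

Lemma polynomial_col_pair (p q : 'I_3 -> ambient R -> R) :
  (forall i, polynomial_function (p i)) ->
  (forall j, polynomial_function (q j)) ->
  polynomial_map (fun z => (\col_i p i z, \col_j q j z) : ambient R).
Proof.
move=> pp pq.
have -> : (fun z => (\col_i p i z, \col_j q j z) : ambient R) = (fun z =>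
    \sum_i (p i z *: ((delta_mx i 0, 0) : ambient R) +
            q i z *: ((0, delta_mx i 0) : ambient R))).
  apply/funext => z; rewrite [RHS]surjective_pairing.
  rewrite (big_morph (fun x : ambient R => x.1) (fun _ _ => erefl) erefl).
  rewrite (big_morph (fun x : ambient R => x.2) (fun _ _ => erefl) erefl).
  congr (_, _); apply/colP => i; rewrite !mxE summxE (bigD1 i) //=.
    rewrite big1 ?addr0 => [|j ji]; rewrite !mxE eqxx ?mulr0 ?addr0.
      by rewrite eqxx mulr1.
    by rewrite eq_sym (negbTE ji) mulr0.
  rewrite big1 ?addr0 => [|j ji]; rewrite !mxE eqxx ?mulr0 ?add0r.
    by rewrite eqxx mulr1.
  by rewrite eq_sym (negbTE ji) mulr0.
by apply: polynomial_map_sum => i; apply: polynomial_mapD;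
  apply: polynomial_map_scale.
Qed.

(** Only the values of X on the reduced space matter, so X may be a polynomial
    representative of a Hamiltonian vector field given by rational formulas. *)
Lemma hamiltonian_section (G : ambient R -> R) (X : ambient R -> ambient R) :
  polynomial_function G -> polynomial_map X ->
  (forall z, reduced_space z -> X z = ham_vec m r I G z) ->
  section_of (char_distribution m r I) X.
Proof.
move=> pG pX XE; have vX : vector_field X.
  split=> [|z Rz]; first exact: polynomial_map_smooth.
  by rewrite XE //; exact: ham_vec_tangent.
split=> // z Rz; exists G, X; split=> //.
  exact: polynomial_smooth_function.
by split=> // F2 _ y Ry; rewrite bracketE XE.
Qed.

(** The vector M with {K_i, K_j} = - c_ijl M_l; it differs from K by the effect
    of the rolling constraint. *)
Definition moment z l : R :=
  z.1 l 0 + m * r ^+ 2 * (omega_b m r I z l 0 - omega_s3 m r I z * z.2 l 0).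

(** The one-form alpha = gamma . dK + M . dgamma. *)
Definition contact_form z v : R :=
  \sum_l (z.2 l 0 * v.1 l 0 + moment z l * v.2 l 0).

(** With a = dG/dK and b = dG/dgamma this is
    gamma . (M x a + gamma x b) + M . (gamma x a) = 0, a sum of two opposite
    triple products and a triple product with a repeated factor. *)
Lemma contact_form_ham_vec (G : ambient R -> R) z :
  contact_form z (ham_vec m r I G z) = 0.
Proof.
have KKE i j : brKK m r I i j z = - \sum_l levi_civita R i j l * moment z l.
  by [].
rewrite /contact_form !sum_I3 /ham_vec /= !mxE !sum_I3 !KKE /brKgamma !sum_I3.
rewrite /levi_civita /=; ring.
Qed.

(** The defining property of a Hamiltonian vector field, tested on the six
    coordinate functions, forces it to agree with the explicit vector
    [ham_vec], on which alpha vanishes. *)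
Lemma contact_form_char_distribution z v : reduced_space z ->
  char_distribution m r I z v -> contact_form z v = 0.
Proof.
move=> Rz [F [X [sF [_ XF] ->]]]; rewrite -(contact_form_ham_vec F z).
congr contact_form; rewrite [LHS]surjective_pairing [RHS]surjective_pairing.
congr (_, _); apply/colP => i.
  have := XF _ (polynomial_smooth_function (polynomial_K i)) z Rz.
  by rewrite bracketE !(diff_cK i).
have := XF _ (polynomial_smooth_function (polynomial_gamma i)) z Rz.
by rewrite bracketE !(diff_cgamma i).
Qed.

End contact_form.

(** * Clearing the denominator Y *)

Section clearing_denominators.
Set Implicit Arguments.
Unset Strict Implicit.
Variables (R : realType) (m r : R) (I : 'rV[R]_3).
Hypotheses (m_gt0 : 0 < m) (r_gt0 : 0 < r) (I_gt0 : forall i, 0 < I 0 i).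
Implicit Types (z v : ambient R) (i j l : 'I_3).

Local Notation mu := (m * r ^+ 2).
Local Notation Y z := (Y_fun m r I z.2).

Let mu_gt0 : 0 < mu. Proof. by rewrite mulr_gt0 ?exprn_gt0. Qed.

Lemma A_gt0 i : 0 < I 0 i + mu. Proof. by rewrite addr_gt0. Qed.

Lemma invA_mulE (w : 'cV[R]_3) i :
  (invmx (A_mx m r I) *m w) i 0 = w i 0 / (I 0 i + mu).
Proof.
have AE : A_mx m r I = diag_mx (\row_k (I 0 k + mu)).
  by apply/matrixP => k l; rewrite !mxE mulrnDl.
have Au : A_mx m r I \in unitmx.
  rewrite AE unitmxE det_diag unitfE; apply/prodf_neq0 => k _.
  by rewrite mxE gt_eqF // A_gt0.
have wE : A_mx m r I *m (\col_k (w k 0 / (I 0 k + mu))) = w.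
  apply/colP => k; rewrite AE mul_diag_mx !mxE mulrC divfK //.
  by rewrite gt_eqF // A_gt0.
by rewrite -{1}wE mulKmx // mxE.
Qed.

Lemma Y_funE (g : 'cV[R]_3) :
  Y_fun m r I g = 1 - mu * \sum_k g k 0 * (g k 0 / (I 0 k + mu)).
Proof. by rewrite /Y_fun /dot; under eq_bigr do rewrite invA_mulE. Qed.

(** Replacing 1 by |gamma|^2 turns Y into the sum of
    gamma_k^2 I_k / (I_k + mu), which has positive coefficients. *)
Lemma Y_gt0 z : reduced_space z -> 0 < Y z.
Proof.
rewrite /reduced_space /= => gg1.
have -> : Y z = \sum_k I 0 k / (I 0 k + mu) * z.2 k 0 ^+ 2.
  rewrite Y_funE -gg1 /dot mulr_sumr -sumrB; apply: eq_bigr => k _.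
  by have := lt0r_neq0 (A_gt0 k) => Ak; field.
have c_gt0 k : 0 < I 0 k / (I 0 k + mu) by rewrite divr_gt0 ?A_gt0.
have c_ge0 k : true -> 0 <= I 0 k / (I 0 k + mu) * z.2 k 0 ^+ 2.
  by move=> _; rewrite mulr_ge0 ?sqr_ge0 ?ltW.
rewrite lt0r sumr_ge0 ?andbT //; apply: contra_eq_neq gg1.
move=> /eqP; rewrite psumr_eq0 // => /allP all0.
rewrite /dot big1 1?eq_sym ?oner_eq0 // => k _.
have /= := all0 k (mem_index_enum k).
by rewrite mulf_eq0 gt_eqF //= sqrf_eq0 => /eqP ->; rewrite mul0r.
Qed.

Lemma omega_s3E z : omega_s3 m r I z =
  (\sum_k z.1 k 0 * (z.2 k 0 / (I 0 k + mu))) / Y z.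
Proof. by rewrite /omega_s3 /dot; under eq_bigr do rewrite invA_mulE. Qed.

Lemma momentE z l : moment m r I z l =
  z.1 l 0 + mu * (z.1 l 0 / (I 0 l + mu)
    + mu * omega_s3 m r I z * (z.2 l 0 / (I 0 l + mu))
    - omega_s3 m r I z * z.2 l 0).
Proof.
have scaleE a (w : 'cV[R]_3) : (a *: w) l 0 = a * w l 0 by rewrite mxE.
by rewrite /moment /omega_b mxE scaleE !invA_mulE.
Qed.

(** The polynomial that represents Y M_l: here N = K . A^-1 gamma is the
    numerator of omega_3 = N / Y. *)
Definition Y_moment z l : R :=
  let N := \sum_k z.1 k 0 * (z.2 k 0 / (I 0 k + mu)) in
  Y z * z.1 l 0 + mu * (Y z * (z.1 l 0 / (I 0 l + mu))
    + mu * N * (z.2 l 0 / (I 0 l + mu)) - N * z.2 l 0).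

Lemma Y_momentE z l : reduced_space z -> Y z * moment m r I z l = Y_moment z l.
Proof.
move=> /Y_gt0/lt0r_neq0 Y0.
rewrite momentE omega_s3E /Y_moment /=.
by have A0 := lt0r_neq0 (A_gt0 l); field; apply/andP.
Qed.

Lemma polynomial_Y : polynomial_function (fun z : ambient R => Y z).
Proof.
rewrite (_ : (fun z : ambient R => Y z) = (fun z =>
    1 + (- mu) * \sum_k z.2 k 0 * ((I 0 k + mu)^-1 * z.2 k 0))).
  apply: polynomialD; first exact: polynomial_cst.
  apply/polynomialZ/polynomial_sum => k.
  by apply: polynomialM; [|apply: polynomialZ]; exact: polynomial_gamma.
apply/funext => z; rewrite Y_funE mulNr; congr (1 - _ * _).
by apply: eq_bigr => k _; rewrite (mulrC _^-1).
Qed.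

Lemma polynomial_Y_moment l : polynomial_function (fun z => Y_moment z l).
Proof.
have pN : polynomial_function (fun z : ambient R =>
    \sum_k z.1 k 0 * (z.2 k 0 / (I 0 k + mu))).
  apply: polynomial_sum => k; apply: polynomialM; first exact: polynomial_K.
  by apply: polynomialM; [exact: polynomial_gamma | exact: polynomial_cst].
have pK := polynomialM polynomial_Y (polynomial_K R l).
apply: polynomialD => //; apply: polynomialZ.
apply: polynomialD; last first.
  by apply: polynomialN; apply: polynomialM => //; exact: polynomial_gamma.
apply: polynomialD.
  apply: polynomialM; first exact: polynomial_Y.
  by apply: polynomialM; [exact: polynomial_K | exact: polynomial_cst].
apply: polynomialM; first exact: polynomialZ.
by apply: polynomialM; [exact: polynomial_gamma | exact: polynomial_cst].
Qed.

(** * Two polynomial Hamiltonian sections *)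

Lemma polynomial_brKgamma i j : polynomial_function (brKgamma (R := R) i j).
Proof.
apply/polynomialN/polynomial_sum => l.
exact/polynomialZ/polynomial_gamma.
Qed.

(** The Hamiltonian vector field (gamma x e_0, 0) of the function gamma_0. *)
Definition gamma_field z : ambient R := (\col_i brKgamma i 0 z, \col_j 0).

Lemma polynomial_gamma_field : polynomial_map gamma_field.
Proof.
apply: polynomial_col_pair => i; last exact: polynomial_cst.
exact: polynomial_brKgamma.
Qed.

Lemma gamma_field_section : section_of (char_distribution m r I) gamma_field.
Proof.
apply: (@hamiltonian_section _ m r I (fun z => z.2 0 0)).
- exact: polynomial_gamma.
- exact: polynomial_gamma_field.
move=> z _; have dK0 j : dK (fun z : ambient R => z.2 0 0) j z = 0.
  by rewrite /dK (diff_cgamma 0) mxE.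
have dg j : dgamma (fun z : ambient R => z.2 0 0) j z = (0 == j)%:R.
  by rewrite /dgamma (diff_cgamma 0) mxE andbT.
congr (_, _); apply/colP => i; rewrite !mxE.
  by rewrite sum_I3 !dK0 !dg /=; ring.
by rewrite sum_I3 !dK0; ring.
Qed.

Definition YK z : R := Y z * z.1 0 0.

Lemma polynomial_YK : polynomial_function YK.
Proof. by apply: polynomialM; [exact: polynomial_Y | exact: polynomial_K]. Qed.

(** Y depends on gamma only, so Y K_0 is affine in K. *)
Lemma dK_YK j z : dK YK j z = (0 == j)%:R * Y z.
Proof.
apply: (@diff_affine _ _ R^o).
  by have [+ _] := polynomial_diff polynomial_YK; exact.
move=> t; rewrite /YK /= !mxE scaler0 addr0 andbT.
by rewrite -[_ *: _]/(t * ((0 == j)%:R * Y z)); ring.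
Qed.

(** The Hamiltonian vector field of Y K_0, where the rational factor Y M has been
    replaced by its polynomial representative. The gradient of Y with respect
    to gamma is kept unexpanded, since it contributes only terms gamma x b,
    whose component along gamma vanishes. *)
Definition YK_field z : ambient R :=
  (\col_i (- \sum_l levi_civita R i 0 l * Y_moment z l
           + \sum_j dgamma YK j z * brKgamma i j z),
   \col_j - (Y z * brKgamma 0 j z)).

Lemma polynomial_YK_field_K i : polynomial_function (fun z => (YK_field z).1 i 0).
Proof.
under eq_fun do rewrite mxE.
apply: polynomialD.
  by apply/polynomialN/polynomial_sum => l; exact/polynomialZ/polynomial_Y_moment.
apply: polynomial_sum => j; apply: polynomialM; last exact: polynomial_brKgamma.
by have [_] := polynomial_diff polynomial_YK; exact.
Qed.

Lemma polynomial_YK_field : polynomial_map YK_field.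
Proof.
apply: polynomial_col_pair => i.
  by have := polynomial_YK_field_K i; under eq_fun do rewrite mxE.
apply/polynomialN/polynomialM; first exact: polynomial_Y.
exact: polynomial_brKgamma.
Qed.

Lemma YK_field_section : section_of (char_distribution m r I) YK_field.
Proof.
apply: (hamiltonian_section polynomial_YK polynomial_YK_field) => z Rz.
congr (_, _); apply/colP => i; rewrite !mxE.
  rewrite big_split /=; congr (_ + _).
  rewrite [RHS]sum_I3 !dK_YK /= !mul0r !addr0 mul1r /brKK mulrN; congr (- _).
  by rewrite mulr_sumr; apply: eq_bigr => l _; rewrite mulrCA Y_momentE.
by rewrite sum_I3 !dK_YK /= !mul0r !addr0 mul1r.
Qed.

(** * A Lie bracket that leaves the distribution *)

(** At K = 0 the vector M vanishes too, so alpha reduces to the component of dK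
    along gamma = e_2. *)
Definition pole : ambient R := (0, delta_mx 2 0).

Lemma pole_reduced : reduced_space pole.
Proof. by rewrite /reduced_space /= /dot sum_I3 !mxE /=; ring. Qed.

Lemma contact_form_pole v : contact_form m r I pole v = v.1 2 0.
Proof.
have M0 l : moment m r I pole l = 0.
  rewrite momentE omega_s3E sum_I3 !mxE /=; ring.
by rewrite /contact_form sum_I3 !M0 !mxE /=; ring.
Qed.

Lemma diff_K_coord (f : ambient R -> ambient R) i z v : differentiable f z ->
  ('d f z v).1 i 0 = 'd (fun x => (f x).1 i 0 : R^o) z v.
Proof.
move=> df; have dc : differentiable (fun x : ambient R => x.1 i 0 : R^o) (f z).
  by have [+ _] := polynomial_diff (polynomial_K R i); exact.
have := diff_comp df dc.
move=> /(f_equal (fun h : ambient R -> R^o => h v)) /= ->.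
by rewrite (diff_cK i).
Qed.

Lemma pole_gamma_field : gamma_field pole = (delta_mx 1 0, 0).
Proof.
congr (_, _); apply/colP; last by move=> j; rewrite !mxE.
by apply: I3P; rewrite !mxE /brKgamma sum_I3 /levi_civita !mxE /=; ring.
Qed.

(** Along this line gamma = e_2 stays fixed and K = c e_1, so the component along
    gamma of gamma x b vanishes for every b, and what remains is the
    component of Y M x e_0, linear in K. *)
Lemma YK_field_pole_K c :
  (YK_field (pole + c *: ((delta_mx 1 0, 0) : ambient R))).1 2 0
  = - (c * (Y pole * (1 + mu / (I 0 1 + mu)))).
Proof.
have -> : pole + c *: ((delta_mx 1 0, 0) : ambient R)
    = (c *: delta_mx 1 0, delta_mx 2 0).
  by congr (_, _); rewrite /= ?add0r ?scaler0 ?addr0.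
rewrite mxE [X in _ + X]big1 => [|j _].
  rewrite addr0; congr (- _); rewrite sum_I3 /levi_civita /=.
  rewrite !mul0r add0r addr0 mul1r /Y_moment sum_I3 /= !mxE /=.
  by move: (Y_fun _ _ _ _) => y; ring.
suff -> : brKgamma 2 j (c *: delta_mx 1 0, delta_mx 2 0) = 0 :> R.
  by rewrite mulr0.
by elim/I3P: j; rewrite /brKgamma sum_I3 /levi_civita !mxE /=; ring.
Qed.

(** The derivative of X_(Y K_0) along X_(gamma_0) contributes
    - Y (1 + mu / (I_1 + mu)) and that of X_(gamma_0) along X_(Y K_0)
    contributes - Y. The two would cancel in the difference if M were equal to
    K; the excess comes from the term mu omega of M. *)
Lemma contact_form_lie_bracket :
  contact_form m r I pole (lie_bracket gamma_field YK_field pole)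
  = - (mu * Y pole / (I 0 1 + mu)).
Proof.
have [dX _] := polynomial_map_diff polynomial_gamma_field.
have [dZ _] := polynomial_map_diff polynomial_YK_field.
(* X_(gamma_0) is a linear map, hence its own differential. *)
have XZ : 'd gamma_field pole (YK_field pole) =
    gamma_field (YK_field pole).
  apply: diff_affine => // t; congr (_, _); apply/colP => i; rewrite !mxE.
    by rewrite /brKgamma !sum_I3 !mxE; ring.
  by ring.
have ZX : ('d YK_field pole (gamma_field pole)).1 2 0 =
    - (Y pole * (1 + mu / (I 0 1 + mu))).
  rewrite diff_K_coord // pole_gamma_field; apply: (@diff_affine _ _ R^o) => [|t].
    by have [+ _] := polynomial_diff (polynomial_YK_field_K 2); exact.
  rewrite YK_field_pole_K; have := YK_field_pole_K 0.
  rewrite scale0r addr0 mul0r oppr0 => ->.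
  by rewrite add0r; exact/esym/mulrN.
rewrite contact_form_pole !mxE ZX XZ !mxE /brKgamma !sum_I3 !mxE.
rewrite /brKgamma !sum_I3 !mxE /levi_civita /=; ring.
Qed.

End clearing_denominators.

Theorem theorem6p9 (R : realType) (m r : R) (I : 'rV[R]_3)
  (m_gt0 : 0 < m) (r_gt0 : 0 < r) (I_gt0 : forall i, 0 < I 0 i) :
  ~ frobenius_integrable (char_distribution m r I).
Proof.
move=> integrable.
have Rp := pole_reduced R.
have sX := gamma_field_section m r I.
have sY := YK_field_section m_gt0 r_gt0 I_gt0.
have := contact_form_char_distribution Rp (integrable _ _ sX sY _ Rp).
rewrite contact_form_lie_bracket //; apply/eqP; rewrite oppr_eq0 gt_eqF //.
by rewrite divr_gt0 ?A_gt0 // !mulr_gt0 ?exprn_gt0 ?Y_gt0.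
Qed.
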